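(* Let $\|\cdot\|$ be an induced norm. If $\mathcal{F}$ and $\mathcal{G}$ are continuously differentiable, then the Parareal iteration $U\mapsto U+v(U)$ is locally contractive. The Jacobian of the iteration satisfies $$\|I+\mathcal{D}v(U)\|\le\beta,$$ where $$\beta=\left(\sup_{U,\;1\le n\le N}\frac{\|\mathcal{D}\mathcal{G}(U_n)\|^N-1}{\|\mathcal{D}\mathcal{G}(U_n)\|-1}\right)\left(\sup_{U,\;0\le n\le N-1}\|\mathcal{D}\mathcal{F}(U_n)-\mathcal{D}\mathcal{G}(U_n)\|\right).$$
   Context: Let $d,N\ge1$ be integers and $u_0\in\mathbb{R}^d$ a given initial value. Vectors $U\in\mathbb{R}^{d(N+1)}$ are written $U=[U_0^\top,\dots,U_N^\top]^\top$ with $U_n\in\mathbb{R}^d$. The maps $\mathcal{F},\mathcal{G}:\mathbb{R}^d\to\mathbb{R}^d$ are the fine and coarse propagators over one time chunk. The fine solution $U^*$ is given by $U_0^*=u_0$, $U_n^*=\mathcal{F}(U_{n-1}^* )$ for $1\le n\le N$. The Parareal iteration is $U^k=U^{k-1}+v(U^{k-1})$, where $v=(v_0,\dots,v_N):\mathbb{R}^{d(N+1)}\to\mathbb{R}^{d(N+1)}$ is defined recursively by $$v_0(U)=u_0-U_0,\qquad v_n(U)=\mathcal{G}\bigl(U_{n-1}+v_{n-1}(U)\bigr)-U_n+\bigl(\mathcal{F}(U_{n-1})-\mathcal{G}(U_{n-1})\bigr),\quad 1\le n\le N.$$ For $n\ge1$ this is the update $U_n^k=\mathcal{G}(U_{n-1}^k)+\mathcal{F}(U_{n-1}^{k-1})-\mathcal{G}(U_{n-1}^{k-1})$.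 $\mathcal{D}$ denotes the Jacobian (total derivative) and $I$ the identity on $\mathbb{R}^{d(N+1)}$. The induced norm is the matrix norm induced by a vector $p$-norm, with the same $p$ on $\mathbb{R}^d$ and on $\mathbb{R}^{d(N+1)}$. The suprema are over all $U\in\mathbb{R}^{d(N+1)}$ and the indicated $n$. The quotient $\frac{x^N-1}{x-1}$ is read as $\sum_{i=0}^{N-1}x^i$ (so it equals $N$ at $x=1$). ''Locally contractive'' means that there is a convex open neighbourhood of $U^*$ on which $\|I+\mathcal{D}v(U)\|$ is bounded by a constant less than $1$.
   Formalization: Local contractivity is false in the given p-norm (d=N=1, F(x)=2x, G=0 gives norm 2); it is stated instead for the norm induced by a p-norm with the same p after rescaling each chunk U_n by some positive weight; the bound by β is kept in the given p-norm. *)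

(* Defs.v *)
From HB Require Import structures.
From mathcomp Require Import all_boot all_order all_algebra.
From mathcomp Require Import all_classical all_reals all_analysis.

Set Implicit Arguments.
Unset Strict Implicit.
Unset Printing Implicit Defensive.

Import Order.TTheory GRing.Theory Num.Theory.
Import numFieldNormedType.Exports.

Local Open Scope classical_set_scope.
Local Open Scope ring_scope.

(* R^d is 'rV[R]_d, and the stacked vectors U = (U_0, ..., U_N) of R^(d(N+1))
   are the matrices 'M[R]_(N.+1, d) whose n-th row is U_n. *)

(* Entrywise l^p norm, for 1 <= p <= +oo; the library norm `|x| of a matrix is
   the maximum of the absolute values of its entries.  On 'rV[R]_d it is the
   p-norm of R^d, and on 'M[R]_(N.+1, d) the p-norm of R^(d(N+1)). *)
Definition pnorm (R : realType) (p : \bar R) (m n : nat) (x : 'M[R]_(m, n)) : R :=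
  match p with
  | EFin q => (\sum_i \sum_j `|x i j| `^ q) `^ q^-1
  | +oo%E => `|x|
  | -oo%E => 0
  end.

(* The p-norm after rescaling of the n-th time chunk by w n;
   w = 1 gives pnorm p. *)
Definition weighted_pnorm (R : realType) (p : \bar R) (N d : nat)
    (w : 'I_N.+1 -> R) (U : 'M[R]_(N.+1, d)) : R :=
  pnorm p (\matrix_(n < N.+1, j < d) (w n * U n j)).

(* The matrix norm induced by the vector norms nV and nW. *)
Definition opnorm (R : realType) (V W : lmodType R) (nV : V -> R) (nW : W -> R)
    (A : V -> W) : R :=
  sup [set nW (A x) | x in [set x | nV x <= 1]].

Definition continuously_differentiable (R : realType) (m n : nat)
    (f : 'rV[R]_m -> 'rV[R]_n) : Prop :=
  (forall x, differentiable f x) /\ continuous (jacobian f).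

Section Parareal.
Variables (R : realType) (d : nat).

(* v_n(U); inord n is the index n of 'I_N.+1 as long as n <= N, and only these
   values are used in parareal_v. *)
Fixpoint parareal_corr (u0 : 'rV[R]_d) (F G : 'rV[R]_d -> 'rV[R]_d) (N : nat)
    (U : 'M[R]_(N.+1, d)) (n : nat) : 'rV[R]_d :=
  match n with
  | 0%N => u0 - row (inord 0) U
  | m.+1 => G (row (inord m) U + parareal_corr u0 F G U m) - row (inord m.+1) U
            + (F (row (inord m) U) - G (row (inord m) U))
  end.

Definition parareal_v (u0 : 'rV[R]_d) (F G : 'rV[R]_d -> 'rV[R]_d) (N : nat)
    (U : 'M[R]_(N.+1, d)) : 'M[R]_(N.+1, d) :=
  \matrix_(n < N.+1) parareal_corr u0 F G U n.

Definition fine_solution (u0 : 'rV[R]_d) (F : 'rV[R]_d -> 'rV[R]_d) (N : nat) :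
    'M[R]_(N.+1, d) :=
  \matrix_(n < N.+1) iter n F u0.

(* || I + D v(U) ||, with the matrix norm induced by nrm on R^(d(N+1)). *)
Definition iteration_jacobian_norm (u0 : 'rV[R]_d)
    (F G : 'rV[R]_d -> 'rV[R]_d) (N : nat) (nrm : 'M[R]_(N.+1, d) -> R)
    (U : 'M[R]_(N.+1, d)) : R :=
  opnorm nrm nrm (fun H : 'M[R]_(N.+1, d) => H + 'd (@parareal_v u0 F G N) U H).

Definition locally_contractive (u0 : 'rV[R]_d) (F G : 'rV[R]_d -> 'rV[R]_d)
    (N : nat) (nrm : 'M[R]_(N.+1, d) -> R) : Prop :=
  exists (O : set 'M[R]_(N.+1, d)) (c : R),
    [/\ open O, convex_set O, O (fine_solution u0 F N), c < 1 &
        forall U, O U -> iteration_jacobian_norm u0 F G nrm U <= c].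

(* Both suprema may be +oo.  The first one is at least 1 when 0 < N, so the
   only degenerate product is +oo * 0 = 0, with 'd F = 'd G everywhere. *)
Definition beta (p : \bar R) (F G : 'rV[R]_d -> 'rV[R]_d) (N : nat) : \bar R :=
  (ereal_sup [set y | exists (U : 'M[R]_(N.+1, d)) (n : 'I_N.+1),
       (1 <= n)%N /\
       y = (\sum_(i < N)
              opnorm (@pnorm R p 1 d) (@pnorm R p 1 d) ('d G (row n U)) ^+ i)%:E]
   *
   ereal_sup [set y | exists (U : 'M[R]_(N.+1, d)) (n : 'I_N.+1),
       (n <= N.-1)%N /\
       y = (opnorm (@pnorm R p 1 d) (@pnorm R p 1 d)
              (fun h => 'd F (row n U) h - 'd G (row n U) h))%:E])%E.

End Parareal.

(* Main.v *)
Require Import Defs.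
From HB Require Import structures.
From mathcomp Require Import all_boot all_order all_algebra.
From mathcomp Require Import all_classical all_reals all_analysis.
From mathcomp Require Import ring.
Import Order.TTheory GRing.Theory Num.Theory.
Import numFieldNormedType.Exports.
Local Open Scope classical_set_scope.
Local Open Scope ring_scope.

(** One Parareal sweep sends U to the vector whose n-th chunk T_n(U) satisfies
    T_0(U) = u_0 and T_{n+1}(U) = G(T_n(U)) + F(U_n) - G(U_n).  Differentiating
    in the direction H, the chunks K_n of (I + Dv(U)) H satisfy K_0 = 0 and
      K_{n+1} = DG(T_n(U)) K_n + (DF(U_n) - DG(U_n)) H_n
    ([row0_iteration_diff], [rowS_iteration_diff]).  If a and b bound the norms
    of the two matrices, then the chunk norms satisfy
    |K_{n+1}| <= a |K_n| + b |H_n|, so that |K_n| is at most the convolution of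
    (a^i b)_i with the delayed chunk norms of H.  A delay does not increase the
    p-norm of a sequence, hence Minkowski's inequality gives
      |K|_p <= (1 + a + ... + a^(N-1)) b |H|_p        ([pnorm_recursion]).

    Global bound.  For a fixed U only the N points T_n(U) and the N points U_n
    matter; a and b are taken as maxima over these points, which are attained,
    so each factor is one of the elements of the set whose supremum is the
    corresponding factor of beta.

    Local contraction.  In the norm that scales the n-th chunk by eps^n, the
    recursion holds with eps a and eps b instead of a and b.  The Jacobians are
    continuous, so a and b can be chosen uniformly on a ball around the fine
    solution, and the bound drops below 1 once eps is small. *)

(** * The entrywise p-norm *)

Section PNorm.
Context {R : realType}.
Implicit Types (p : \bar R) (q : R).

Lemma exponent_ind (P : \bar R -> Prop) :
  (forall q, 1 <= q -> P q%:E) -> P +oo%E -> forall p, (1 <= p)%E -> P p.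
Proof.
move=> hE hy [q| |] hp; first by apply: hE; rewrite lee_fin in hp.
  exact: hy.
by move: hp; rewrite leeNy_eq.
Qed.

Lemma mx_norm_le_entries {m n} (x : 'M[R]_(m, n)) (r : R) :
  0 <= r -> (forall i j, `|x i j| <= r) -> `|x| <= r.
Proof.
move=> r0 xr; rewrite /Num.norm /= mx_normrE.
by apply/bigmax_leP; split => // -[i j] _ /=; exact: xr.
Qed.

Lemma ler_entry_mx_norm {m n} (x : 'M[R]_(m, n)) i j : `|x i j| <= `|x|.
Proof.
by rewrite [leRHS]/Num.norm /= mx_normrE; apply/bigmax_geP; right; exists (i, j).
Qed.

Lemma pnorm_EFin_le {m n} q (x : 'M[R]_(m, n)) (r : R) : 1 <= q -> 0 <= r ->
  (pnorm q%:E x <= r) = (\sum_i \sum_j `|x i j| `^ q <= r `^ q).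
Proof.
move=> q1 r0; have q0 : 0 < q by exact: lt_le_trans q1.
have s0 : 0 <= \sum_i \sum_j `|x i j| `^ q.
  by apply: sumr_ge0 => i _; apply: sumr_ge0 => j _; exact: powR_ge0.
have rE : r = (r `^ q) `^ q^-1 by rewrite -powRrM mulfV ?gt_eqF// powRr1.
rewrite /pnorm; apply/idP/idP => [|h].
  move=> /(ge0_ler_powR (ltW q0)).
  rewrite -powRrM mulVf ?gt_eqF// powRr1//.
  by apply; rewrite nnegrE ?powR_ge0.
rewrite rE; apply: ge0_ler_powR => //; first by rewrite invr_ge0 ltW.
by rewrite nnegrE powR_ge0.
Qed.

Lemma pnorm_ge0 {m n} p (x : 'M[R]_(m, n)) : 0 <= pnorm p x.
Proof. by case: p => [q| |] //=; exact: powR_ge0. Qed.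

Lemma le_pnorm {m n} p (x y : 'M[R]_(m, n)) : (1 <= p)%E ->
  (forall i j, `|x i j| <= `|y i j|) -> pnorm p x <= pnorm p y.
Proof.
move: p; apply: exponent_ind => [q hp|] xy; rewrite /pnorm; last first.
  apply: mx_norm_le_entries => [|i j]; first exact: normr_ge0.
  exact: le_trans (xy i j) (ler_entry_mx_norm _ _ _).
have q0 : 0 <= q by exact: le_trans hp.
apply: ge0_ler_powR; rewrite ?invr_ge0// ?nnegrE.
- by apply: sumr_ge0 => i _; apply: sumr_ge0 => j _; exact: powR_ge0.
- by apply: sumr_ge0 => i _; apply: sumr_ge0 => j _; exact: powR_ge0.
- apply: ler_sum => i _; apply: ler_sum => j _.
  by apply: ge0_ler_powR; rewrite ?nnegrE.
Qed.

Lemma pnormZ {m n} p (c : R) (x : 'M[R]_(m, n)) : (1 <= p)%E ->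
  pnorm p (c *: x) = `|c| * pnorm p x.
Proof.
move: p; apply: exponent_ind => [q hp|]; last exact: mx_normZ.
rewrite /pnorm; have q0 : 0 < q by exact: lt_le_trans hp.
rewrite [X in X `^ _](_ : _ = `|c| `^ q * \sum_i \sum_j `|x i j| `^ q).
  rewrite powRM ?powR_ge0//.
    by rewrite -powRrM mulfV ?gt_eqF// powRr1.
  by apply: sumr_ge0 => i _; apply: sumr_ge0 => j _; exact: powR_ge0.
rewrite mulr_sumr; apply: eq_bigr => i _; rewrite mulr_sumr.
by apply: eq_bigr => j _; rewrite mxE normrM powRM.
Qed.

Lemma pnorm0 {m n} p : (1 <= p)%E -> pnorm p (0 : 'M[R]_(m, n)) = 0.
Proof. by move=> hp; rewrite -(scale0r 0) pnormZ// normr0 mul0r. Qed.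

Lemma mx_norm_le_pnorm {m n} p (x : 'M[R]_(m, n)) : (1 <= p)%E ->
  `|x| <= pnorm p x.
Proof.
move: p; apply: exponent_ind => [q hp|]; last exact: lexx.
rewrite /pnorm; have q0 : 0 < q by exact: lt_le_trans hp.
apply: mx_norm_le_entries => [|i j]; first exact: powR_ge0.
rewrite -[leLHS](@powRr1 R)// -(mulfV (lt0r_neq0 q0)) powRrM.
apply: ge0_ler_powR; rewrite ?invr_ge0 ?(ltW q0)// ?nnegrE ?powR_ge0//.
  by apply: sumr_ge0 => k _; apply: sumr_ge0 => l _; exact: powR_ge0.
rewrite (bigD1 i)//= (bigD1 j)//= -addrA lerDl addr_ge0//.
  by apply: sumr_ge0 => k _; exact: powR_ge0.
by apply: sumr_ge0 => k _; apply: sumr_ge0 => l _; exact: powR_ge0.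
Qed.

Lemma pnorm_le_mx_norm {m n} p (x : 'M[R]_(m, n)) : (1 <= p)%E ->
  pnorm p x <= pnorm p (const_mx 1 : 'M[R]_(m, n)) * `|x|.
Proof.
move=> hp; rewrite mulrC -[X in X * _]normr_id -pnormZ//.
apply: le_pnorm => // i j; rewrite !mxE mulr1 normr_id.
exact: ler_entry_mx_norm.
Qed.

Lemma powR_conv q (a b t : R) : 1 <= q -> 0 <= a -> 0 <= b -> 0 <= t <= 1 ->
  (t * a + (1 - t) * b) `^ q <= t * a `^ q + (1 - t) * b `^ q.
Proof.
move=> q1 a0 b0 /andP[t0 t1].
have := @convex_powR R q q1 (Itv01 t0 t1) a b.
rewrite !inE /= !in_itv /= !andbT => /(_ a0 b0).
by rewrite !convRE.
Qed.

(** Minkowski's inequality.  With A = |x|_p, B = |y|_p and t = A / (A + B), the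
    vector (x + y) / (A + B) is the convex combination of x / A and y / B with
    weights t and 1 - t; convexity of the q-th power, summed over the entries,
    puts it in the unit ball. *)
Lemma ler_pnormD {m n} p (x y : 'M[R]_(m, n)) : (1 <= p)%E ->
  pnorm p (x + y) <= pnorm p x + pnorm p y.
Proof.
move: p; apply: exponent_ind => [q q1|]; last exact: ler_normD.
have q0 : 0 < q by exact: lt_le_trans q1.
have := pnorm_ge0 q%:E x; have := pnorm_ge0 q%:E y.
move xE : (pnorm _ x) => A; move yE : (pnorm _ y) => B B_ge0 A_ge0.
move: A_ge0; rewrite le_eqVlt => /predU1P[A0|A0].
  have -> : x = 0.
    by apply/eqP; rewrite -normr_le0 A0 -xE; exact: mx_norm_le_pnorm.
  by rewrite add0r yE lerDr -A0.
move: B_ge0; rewrite le_eqVlt => /predU1P[B0|B0].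
  have -> : y = 0.
    by apply/eqP; rewrite -normr_le0 B0 -yE; exact: mx_norm_le_pnorm.
  by rewrite addr0 xE lerDl -B0.
have AB0 : 0 < A + B by exact: addr_gt0.
rewrite pnorm_EFin_le ?(ltW AB0)//.
have xA : \sum_i \sum_j `|x i j| `^ q <= A `^ q.
  by rewrite -pnorm_EFin_le ?(ltW A0)// xE.
have yB : \sum_i \sum_j `|y i j| `^ q <= B `^ q.
  by rewrite -pnorm_EFin_le ?(ltW B0)// yE.
pose t := A / (A + B).
have tE : 1 - t = B / (A + B) by rewrite /t; field; rewrite gt_eqF.
have t0 : 0 <= t by rewrite divr_ge0 ?ltW.
have t1 : 0 <= 1 - t by rewrite tE divr_ge0 ?ltW.
have key i j : `|(x + y) i j| `^ q <= (A + B) `^ q *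
    (t * (A^-1 `^ q * `|x i j| `^ q) + (1 - t) * (B^-1 `^ q * `|y i j| `^ q)).
  rewrite -!powRM ?invr_ge0 ?(ltW A0) ?(ltW B0)//.
  apply: (@le_trans _ _ (((A + B) *
      (t * (A^-1 * `|x i j|) + (1 - t) * (B^-1 * `|y i j|))) `^ q)).
    apply: ge0_ler_powR; rewrite ?nnegrE ?(ltW q0)//.
      by rewrite mulr_ge0 ?(ltW AB0)// addr_ge0// mulr_ge0// mulr_ge0//
        invr_ge0 ltW.
    rewrite mxE (_ : _ * _ = `|x i j| + `|y i j|); first exact: ler_normD.
    by rewrite tE /t; field; rewrite !gt_eqF.
  have xA0 : 0 <= A^-1 * `|x i j| by rewrite mulr_ge0// invr_ge0 ltW.
  have yB0 : 0 <= B^-1 * `|y i j| by rewrite mulr_ge0// invr_ge0 ltW.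
  have c0 : 0 <= t * (A^-1 * `|x i j|) + (1 - t) * (B^-1 * `|y i j|).
    by apply: addr_ge0; exact: mulr_ge0.
  rewrite powRM ?(ltW AB0)// ler_wpM2l ?powR_ge0//.
  by apply: powR_conv => //; rewrite t0 -subr_ge0.
apply: le_trans (ler_sum _ (fun i _ => ler_sum _ (fun j _ => key i j))) _.
under eq_bigr do rewrite -mulr_sumr big_split /= -!mulr_sumr.
rewrite -mulr_sumr big_split /= -!mulr_sumr -[leRHS]mulr1.
rewrite ler_wpM2l ?powR_ge0//.
have inv1 c : 0 < c -> c^-1 `^ q * c `^ q = 1.
  by move=> c0; rewrite -powRM ?invr_ge0 ?ltW// mulVf ?gt_eqF// powR1.
rewrite -[leRHS](subrKC t) lerD//.
  by rewrite ler_piMr// -(inv1 A)// ler_wpM2l ?powR_ge0.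
by rewrite ler_piMr// -(inv1 B)// ler_wpM2l ?powR_ge0.
Qed.

Lemma ler_pnorm_sum {m n k} p (x : 'I_k -> 'M[R]_(m, n)) : (1 <= p)%E ->
  pnorm p (\sum_i x i) <= \sum_i pnorm p (x i).
Proof.
move=> hp; elim/big_ind2 : _ => [|a b c e ab ce|//]; first by rewrite pnorm0.
by apply: le_trans (ler_pnormD _ _ _ hp) _; exact: lerD.
Qed.

(** This reduces norm estimates on stacked vectors to estimates on the sequence
    of chunk norms. *)
Lemma pnorm_rows {m n} p (x : 'M[R]_(m, n)) : (1 <= p)%E ->
  pnorm p x = pnorm p (\col_i pnorm p (row i x)).
Proof.
move: p; apply: exponent_ind => [q hp|].
  have q0 : 0 < q by exact: lt_le_trans hp.
  rewrite /pnorm; congr (_ `^ _); apply: eq_bigr => i _.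
  rewrite big_ord1 mxE ger0_norm ?powR_ge0//.
  rewrite big_ord1 -powRrM mulVf ?gt_eqF// powRr1.
    by apply: eq_bigr => j _; rewrite mxE.
  by apply: sumr_ge0 => j _; exact: powR_ge0.
apply/eqP; rewrite eq_le /pnorm; apply/andP; split.
  apply: mx_norm_le_entries => // i j.
  apply: le_trans (ler_entry_mx_norm _ i 0); rewrite mxE normr_id.
  by have := ler_entry_mx_norm (row i x) 0 j; rewrite mxE.
apply: mx_norm_le_entries => // i j; rewrite mxE normr_id.
by apply: mx_norm_le_entries => // k l; rewrite mxE ler_entry_mx_norm.
Qed.

(** * Linear recursions between chunk norms *)

(** The sequence h delayed by i + 1 steps and padded with zeros: the value at n
    is h (n - 1 - i). *)
Definition shiftn (i : nat) (h : nat -> R) (n : nat) : R :=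
  if (i < n)%N then h (n.-1 - i)%N else 0.

Lemma sum_shift (f : nat -> R) i M :
  \sum_(n < M) (if (i < n)%N then f (n.-1 - i)%N else 0)
    = \sum_(n < M - i.+1) f n.
Proof.
elim: M => [|M IH]; first by rewrite !big_ord0.
rewrite big_ord_recr /= IH; case: ltnP => iM.
  by rewrite subSn// big_ord_recr/=; congr (_ + f _); rewrite -subn1 -subnDA.
have e1 : (M.+1 - i.+1 = 0)%N by apply/eqP; rewrite subn_eq0.
have e2 : (M - i.+1 = 0)%N by apply/eqP; rewrite subn_eq0 leqW.
by rewrite e1 e2 !big_ord0 addr0.
Qed.

(** A delay drops the last entries and adds only zeros. *)
Lemma pnorm_shift p i M (h : nat -> R) : (1 <= p)%E ->
  pnorm p (\col_(n < M) shiftn i h n) <= pnorm p (\col_(n < M) h n).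
Proof.
move: p; apply: exponent_ind => [q hp|].
  have q0 : 0 < q by exact: lt_le_trans hp.
  have s0 (x : 'cV[R]_M) : 0 <= \sum_i \sum_j `|x i j| `^ q.
    by apply: sumr_ge0 => k _; apply: sumr_ge0 => l _; exact: powR_ge0.
  apply: ge0_ler_powR; rewrite ?invr_ge0 ?nnegrE ?(ltW q0)//.
  under eq_bigr do rewrite big_ord1 mxE.
  under [leRHS]eq_bigr do rewrite big_ord1 mxE.
  rewrite [leLHS](_ : _ = \sum_(n < M - i.+1) `|h n| `^ q).
    rewrite -!(big_mkord xpredT (fun n => `|h n| `^ q)).
    rewrite [leRHS](@big_cat_nat _ _ _ (M - i.+1)) ?leq_subr//=.
    by rewrite lerDl; apply: sumr_ge0 => k _; exact: powR_ge0.
  rewrite -(sum_shift (fun n => `|h n| `^ q)); apply: eq_bigr => n _.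
  by rewrite /shiftn; case: ifP => // _; rewrite normr0 powR0// gt_eqF.
apply: mx_norm_le_entries => [|n j]; first exact: normr_ge0.
rewrite mxE /shiftn; case: ifP => [i_n|_]; last first.
  by rewrite normr0; exact: normr_ge0.
have lt : (n.-1 - i < M)%N.
  by rewrite (leq_ltn_trans (leq_subr _ _))// (leq_ltn_trans (leq_pred _)).
by have := ler_entry_mx_norm (\col_(n < M) h n) (Ordinal lt) 0; rewrite mxE.
Qed.

(** Variation of constants for k_{n+1} <= a k_n + b h_n.  The sum runs up to N
    for every n, the terms i >= n being zero by definition of the shift, so that
    the right-hand side is one fixed combination of sequences, to which the
    triangle inequality applies. *)
Lemma discrete_duhamel (a b : R) (h k : nat -> R) N : 0 <= a ->
  k 0%N <= 0 -> (forall n, (n < N)%N -> k n.+1 <= a * k n + b * h n) ->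
  forall n, (n <= N)%N -> k n <= \sum_(i < N) (a ^+ i * b) * shiftn i h n.
Proof.
move=> a0 k0 kS.
(* Dropping the zero terms i >= n leaves a sum suited to induction on n. *)
have sub n : (n <= N)%N ->
    \sum_(i < N) (a ^+ i * b) * shiftn i h n
    = \sum_(i < n) (a ^+ i * b) * h (n.-1 - i)%N.
  move=> nN; rewrite (big_ord_widen N (fun i => a ^+ i * b * h (n.-1 - i)%N))//.
  rewrite [RHS]big_mkcond; apply: eq_bigr => i _.
  by rewrite /shiftn; case: ifP; rewrite ?mulr0.
elim=> [|n IH] nN; first by rewrite sub// big_ord0.
rewrite sub// big_ord_recl expr0 mul1r /= subn0.
apply: le_trans (kS n nN) _; rewrite addrC lerD2l.
apply: le_trans (ler_wpM2l a0 (IH (ltnW nN))) _.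
rewrite sub ?(ltnW nN)// mulr_sumr; apply: ler_sum => i _.
by rewrite /bump add1n exprS !mulrA -subn1 -subnDA add1n.
Qed.

(** Young's convolution inequality |g * h|_p <= |g|_1 |h|_p for the kernel
    g_i = a^i b, which is what makes the bound hold for every p with the same
    geometric sum. *)
Lemma pnorm_recursion {N d} p (a b : R) (H K : 'M[R]_(N.+1, d)) :
  (1 <= p)%E -> 0 <= a -> 0 <= b ->
  row (inord 0) K = 0 ->
  (forall n, (n < N)%N -> pnorm p (row (inord n.+1) K) <=
     a * pnorm p (row (inord n) K) + b * pnorm p (row (inord n) H)) ->
  pnorm p K <= (\sum_(i < N) a ^+ i) * b * pnorm p H.
Proof.
move=> hp a0 b0 K0 KS.
pose k n := pnorm p (row (inord n : 'I_N.+1) K).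
pose h n := pnorm p (row (inord n : 'I_N.+1) H).
have kh : forall n, (n <= N)%N ->
    k n <= \sum_(i < N) (a ^+ i * b) * shiftn i h n.
  by apply: discrete_duhamel => //; rewrite /k K0 pnorm0.
have hE : pnorm p H = pnorm p (\col_(n < N.+1) h n).
  rewrite pnorm_rows//; congr pnorm; apply/colP => n.
  by rewrite !mxE /h inord_val.
apply: (@le_trans _ _ (pnorm p
    (\sum_(i < N) (a ^+ i * b) *: \col_(n < N.+1) shiftn i h n))).
  rewrite pnorm_rows//; apply: le_pnorm => // n j.
  rewrite summxE mxE ger0_norm ?pnorm_ge0//.
  apply: le_trans (ler_norm _).
  have := kh n (ltnSE (ltn_ord n)); rewrite /k inord_val => /le_trans; apply.
  by apply: ler_sum => i _; rewrite !mxE.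
apply: le_trans (ler_pnorm_sum _ _ hp) _.
rewrite 2!mulr_suml; apply: ler_sum => i _.
rewrite pnormZ// ger0_norm ?mulr_ge0 ?exprn_ge0//.
by rewrite ler_wpM2l ?mulr_ge0 ?exprn_ge0// hE pnorm_shift.
Qed.

End PNorm.

(** * Induced norms of matrices *)

Section OpNorm.
Context {R : realType}.

Lemma opnorm_le {V W : lmodType R} (nV : V -> R) (nW : W -> R) (A : V -> W)
    (c : R) : nV 0 <= 1 -> (forall x, nV x <= 1 -> nW (A x) <= c) ->
  opnorm nV nW A <= c.
Proof.
move=> n0 nc; apply: ge_sup; first by exists (nW (A 0)), 0.
by move=> _ [x /= x1 <-]; exact: nc.
Qed.

Context {d : nat} (p : \bar R) (hp : (1 <= p)%E).
Local Notation nrm := (@pnorm R p 1 d).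
Implicit Types (M : 'M[R]_d) (h : 'rV[R]_d).

(** A constant comparing the induced norm with the maximum of the absolute
    values of the entries; the first factor compares the p-norm of a vector with
    its largest entry. *)
Definition opnorm_const : R := pnorm p (const_mx 1 : 'rV[R]_d) * d%:R.

Lemma opnorm_const_ge0 : 0 <= opnorm_const.
Proof. by rewrite mulr_ge0 ?pnorm_ge0. Qed.

Lemma mx_norm_mulmx h M : `|h *m M| <= d%:R * (`|h| * `|M|).
Proof.
apply: mx_norm_le_entries => [|i j]; first by rewrite !mulr_ge0.
rewrite mxE; apply: le_trans (ler_norm_sum _ _ _) _.
apply: (@le_trans _ _ (\sum_(k < d) `|h| * `|M|)).
  by apply: ler_sum => k _; rewrite normrM ler_pM// ler_entry_mx_norm.
by rewrite sumr_const card_ord mulr_natl.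
Qed.

(** Beyond the comparison of norms, this shows that the set of values defining
    the induced norm is bounded, hence that its supremum is an upper bound. *)
Lemma pnorm_mulmx_le h M : nrm (h *m M) <= opnorm_const * `|M| * nrm h.
Proof.
apply: le_trans (pnorm_le_mx_norm _ _ hp) _.
rewrite /opnorm_const -!mulrA ler_wpM2l ?pnorm_ge0//.
apply: le_trans (mx_norm_mulmx _ _) _.
by rewrite ler_wpM2l// mulrC ler_wpM2l// mx_norm_le_pnorm.
Qed.

Local Notation opn M := (opnorm nrm nrm (fun h => h *m M)).

Lemma opnorm_mulmx_le M : opn M <= opnorm_const * `|M|.
Proof.
apply: opnorm_le => [|h h1]; first by rewrite pnorm0.
apply: le_trans (pnorm_mulmx_le _ _) _.
by rewrite ler_piMr// mulr_ge0// opnorm_const_ge0.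
Qed.

Lemma pnorm_mulmx_unit M h : nrm h <= 1 -> nrm (h *m M) <= opn M.
Proof.
move=> h1; apply: ub_le_sup; last by exists h.
exists (opnorm_const * `|M|) => _ [x /= x1 <-].
apply: le_trans (pnorm_mulmx_le _ _) _.
by rewrite ler_piMr// mulr_ge0// opnorm_const_ge0.
Qed.

Lemma opnorm_mulmx_ge0 M : 0 <= opn M.
Proof.
apply: (@le_trans _ _ (nrm (0 *m M))); first exact: pnorm_ge0.
by apply: pnorm_mulmx_unit; rewrite pnorm0.
Qed.

Lemma pnorm_mulmx_opnorm M h : nrm (h *m M) <= opn M * nrm h.
Proof.
have : 0 <= nrm h by exact: pnorm_ge0.
rewrite le_eqVlt => /predU1P[h0|h0].
  have -> : h = 0.
    by apply/eqP; rewrite -normr_le0 h0; exact: mx_norm_le_pnorm.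
  by rewrite mul0mx !pnorm0// mulr0.
rewrite -ler_pdivrMr// mulrC -{1}(ger0_norm (ltW h0)) -normfV -pnormZ//.
rewrite scalemxAl; apply: pnorm_mulmx_unit.
by rewrite pnormZ// ger0_norm ?invr_ge0 ?(ltW h0)// mulVf// gt_eqF.
Qed.

End OpNorm.

(** * Differentiation of matrix-valued maps *)

Section Calculus.
Context {R : realType}.

Lemma nonexpansive_continuous {V W : normedModType R} (f : {linear V -> W}) :
  (forall x, `|f x| <= `|x|) -> continuous f.
Proof.
move=> f1 x; apply/cvgrPdist_lt => e e0; near=> y.
rewrite -linearB; apply: le_lt_trans (f1 _) _.
by near: y; exact: cvgr_dist_lt.
Unshelve. all: by end_near. Qed.

Lemma row_continuous {m n} (i : 'I_m) : continuous (@row R m n i).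
Proof.
apply: (@nonexpansive_continuous 'M[R]_(m, n) 'rV[R]_n (@row R m n i)) => x.
by apply: mx_norm_le_entries => // k j; rewrite mxE ler_entry_mx_norm.
Qed.

Lemma row_differentiable {m n} (i : 'I_m) (x : 'M[R]_(m, n)) :
  differentiable (@row R m n i) x.
Proof.
exact: (@linear_differentiable R 'M[R]_(m, n) 'rV[R]_n (@row R m n i) x
  (@row_continuous m n i)).
Qed.

Lemma diff_row {m n} (i : 'I_m) (x h : 'M[R]_(m, n)) :
  'd (@row R m n i) x h = row i h.
Proof.
by rewrite (@diff_lin R 'M[R]_(m, n) 'rV[R]_n (@row R m n i) x
  (@row_continuous m n i)).
Qed.

(** A map is the sum of its rows, each put back in place by the linear map
    that multiplies by a standard basis column. *)
Lemma differentiable_rows {V : normedModType R} {m n}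
    (f : V -> 'M[R]_(m, n)) (x : V) :
  (forall i, differentiable (fun u => row i (f u)) x) -> differentiable f x.
Proof.
move=> df.
have -> : f = \sum_(i < m)
    ((mulmx (delta_mx i 0 : 'cV[R]_m)) \o (fun u => row i (f u))).
  apply/funext => u; rewrite fct_sumE /=; apply/matrixP => i j.
  rewrite summxE (bigD1 i)//= big1 ?addr0.
    by rewrite mxE big_ord1 !mxE !eqxx mul1r.
  move=> k ki; rewrite mxE big_ord1 !mxE [i == k]eq_sym (negbTE ki) /=.
  by rewrite mul0r.
apply: differentiable_sum => i; apply: differentiable_comp; first exact: df.
apply: (@linear_differentiable R 'rV[R]_n 'M[R]_(m, n)).
apply: nonexpansive_continuous => y; apply: mx_norm_le_entries => // k j.
rewrite mxE big_ord1 !mxE andbT; case: (k == i); rewrite ?mul0r ?mul1r ?normr0//.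
exact: ler_entry_mx_norm.
Qed.

Lemma row_diff {V : normedModType R} {m n}
    (f : V -> 'M[R]_(m, n)) (x h : V) (i : 'I_m) : differentiable f x ->
  row i ('d f x h) = 'd (fun u => row i (f u)) x h.
Proof.
move=> df; have := diff_comp df (row_differentiable i (f x)).
move=> /(congr1 (fun g => g h)) /= ->.
by rewrite diff_row.
Qed.

Lemma diff_jacobian {m n} (f : 'rV[R]_m -> 'rV[R]_n) (x h : 'rV[R]_m) :
  'd f x h = h *m jacobian f x.
Proof. by rewrite mul_rV_lin1. Qed.

Lemma mx_ball_convex {m n} (x : 'M[R]_(m, n)) (r : R) : convex_set (ball x r).
Proof.
move=> y z t; rewrite !inE -!ball_normE /= => xy xz.
have t0 : 0 <= t%:num by [].
have t1 : 0 <= 1 - t%:num by rewrite subr_ge0.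
rewrite (_ : x - _ = t%:num *: (x - y) + (1 - t%:num) *: (x - z)); last first.
  rewrite !scalerBr addrACA -scalerDl subrKC scale1r -opprD.
  by [].
apply: le_lt_trans (ler_normD _ _) _; rewrite !normrZ !ger0_norm//.
have : 0 < r by exact: le_lt_trans xy.
have [->|tn0] := eqVneq t%:num 0; first by rewrite mul0r add0r subr0 mul1r.
move=> r0; rewrite -[ltRHS]mul1r -[X in _ < X * r](subrKC t%:num) [ltRHS]mulrDl.
by rewrite ltr_leD// ?ler_wpM2l ?(ltW xz)// ltr_pM2l// lt_neqAle eq_sym tn0.
Qed.

End Calculus.

(** * The derivative of one Parareal sweep *)

Lemma diffDB {R : realType} {V W : normedModType R} {f g h : V -> W} {x : V} :
  differentiable f x -> differentiable g x -> differentiable h x -> forall y,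
  'd (f + (g - h)) x y = 'd f x y + ('d g x y - 'd h x y).
Proof.
move=> df dg dh y; have dgh : differentiable (g - h) x by exact: differentiableB.
apply: etrans (congr1 (fun k : V -> W => k y) (diffD df dgh)) _.
exact: (congr1 (fun k : V -> W => 'd f x y + k y) (diffB dg dh)).
Qed.

Lemma diff_compE {R : realType} {U V W : normedModType R} {f : U -> V}
    {g : V -> W} {x : U} : differentiable f x -> differentiable g (f x) ->
  forall y, 'd (g \o f) x y = 'd g (f x) ('d f x y).
Proof.
by move=> df dg y; exact: (congr1 (fun k : U -> W => k y) (diff_comp df dg)).
Qed.

Section Iteration.
Context {R : realType} {d N : nat} (u0 : 'rV[R]_d) (F G : 'rV[R]_d -> 'rV[R]_d).
Context (dF : forall x, differentiable F x) (dG : forall x, differentiable G x).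
Implicit Types (U H : 'M[R]_(N.+1, d)) (n : nat).

(** The n-th chunk of U + v(U), that is T_n(U) above. *)
Definition new_chunk n U : 'rV[R]_d := row (inord n) U + parareal_corr u0 F G U n.

Lemma new_chunk0 U : new_chunk 0 U = u0.
Proof. by rewrite /new_chunk /= subrKC. Qed.

Lemma new_chunkS n U : new_chunk n.+1 U =
  G (new_chunk n U) + (F (row (inord n) U) - G (row (inord n) U)).
Proof. by rewrite {1}/new_chunk /= addrA subrKC. Qed.

Lemma differentiable_new_chunk n U : differentiable (new_chunk n) U.
Proof.
elim: n => [|n IH].
  rewrite (_ : new_chunk 0 = cst u0); first exact: differentiable_cst.
  by apply/funext => V; rewrite new_chunk0.
have drow := @row_differentiable R N.+1 d (inord n) U.
rewrite (_ : new_chunk n.+1 = (G \o new_chunk n) +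
  ((F \o row (inord n)) - (G \o row (inord n)))); last first.
  by apply/funext => V; rewrite new_chunkS.
apply: differentiableD; first exact: differentiable_comp.
by apply: differentiableB; exact: differentiable_comp.
Qed.

Lemma diff_new_chunk0 U H : 'd (new_chunk 0) U H = 0.
Proof.
rewrite (_ : new_chunk 0 = cst u0); first by rewrite diff_cst.
by apply/funext => V; rewrite new_chunk0.
Qed.

Lemma diff_new_chunkS n U H : 'd (new_chunk n.+1) U H =
  'd (new_chunk n) U H *m jacobian G (new_chunk n U) +
  row (inord n) H *m (jacobian F (row (inord n) U) - jacobian G (row (inord n) U)).
Proof.
have drow := @row_differentiable R N.+1 d (inord n) U.
have dup := differentiable_new_chunk n U.
rewrite (_ : new_chunk n.+1 = (G \o new_chunk n) +
  ((F \o row (inord n)) - (G \o row (inord n)))); last first.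
  by apply/funext => V; rewrite new_chunkS.
have dFr : differentiable (F \o row (inord n)) U by exact: differentiable_comp.
have dGr : differentiable (G \o row (inord n)) U by exact: differentiable_comp.
have dGu : differentiable (G \o new_chunk n) U by exact: differentiable_comp.
apply: etrans (diffDB dGu dFr dGr H) _; rewrite mulmxBr.
congr (_ + (_ - _)).
- by apply: etrans (diff_compE dup (dG _) H) _; rewrite diff_jacobian.
- by apply: etrans (diff_compE drow (dF _) H) _; rewrite diff_row diff_jacobian.
- by apply: etrans (diff_compE drow (dG _) H) _; rewrite diff_row diff_jacobian.
Qed.

Lemma differentiable_parareal_v U : differentiable (@parareal_v R d u0 F G N) U.
Proof.
apply: differentiable_rows => i.
rewrite (_ : (fun V => _) = new_chunk i - row i); last first.
  apply/funext => V; rewrite rowK /new_chunk.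
  by rewrite [RHS]/GRing.add /= inord_val addrAC subrr add0r.
apply: differentiableB; [exact: differentiable_new_chunk|].
exact: row_differentiable.
Qed.

Lemma row_iteration_diff n U H : (n <= N)%N ->
  row (inord n) (H + 'd (@parareal_v R d u0 F G N) U H) = 'd (new_chunk n) U H.
Proof.
move=> nN; rewrite linearD /= row_diff; last exact: differentiable_parareal_v.
rewrite (_ : (fun V => _) = new_chunk n - row (inord n)); last first.
  apply/funext => V; rewrite rowK inordK ?ltnS// /new_chunk.
  by rewrite [RHS]/GRing.add /= addrAC subrr add0r.
have dB := diffB (differentiable_new_chunk n U)
  (@row_differentiable R N.+1 d (inord n) U).
apply: etrans
  (congr1 (fun k : 'M[R]_(N.+1, d) -> 'rV[R]_d => row (inord n) H + k H) dB) _.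
rewrite -[RHS](subrKC (row (inord n) H)); congr (_ + (_ - _)).
exact: diff_row.
Qed.

Lemma row0_iteration_diff U H :
  row (inord 0) (H + 'd (@parareal_v R d u0 F G N) U H) = 0.
Proof.
exact: etrans (row_iteration_diff _ _ _ (leq0n N)) (diff_new_chunk0 U H).
Qed.

Lemma rowS_iteration_diff n U H : (n < N)%N ->
  let K := H + 'd (@parareal_v R d u0 F G N) U H in
  row (inord n.+1) K =
    row (inord n) K *m jacobian G (new_chunk n U) + row (inord n) H *m
    (jacobian F (row (inord n) U) - jacobian G (row (inord n) U)).
Proof.
move=> nN K.
have KS : row (inord n.+1) K = 'd (new_chunk n.+1) U H.
  exact: row_iteration_diff.
have Kn : row (inord n) K = 'd (new_chunk n) U H.
  exact: (row_iteration_diff _ _ _ (ltnW nN)).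
by apply: etrans KS _; apply: etrans (diff_new_chunkS n U H) _; rewrite Kn.
Qed.

(** Row n of a vector is multiplied by eps^n in the weighted norm, so passing
    from chunk n to chunk n + 1 costs one factor eps in both coefficients of the
    recursion.  The choice eps = 1 gives the unweighted norm. *)
Lemma iteration_jacobian_norm_le p (eps a b : R) U : (1 <= p)%E ->
  0 <= eps -> 0 <= a -> 0 <= b ->
  (forall n, (n < N)%N -> opnorm (@pnorm R p 1 d) (@pnorm R p 1 d)
     (fun h => h *m jacobian G (new_chunk n U)) <= a) ->
  (forall n, (n < N)%N -> opnorm (@pnorm R p 1 d) (@pnorm R p 1 d)
     (fun h => h *m (jacobian F (row (inord n) U) - jacobian G (row (inord n) U)))
     <= b) ->
  iteration_jacobian_norm u0 F G
    (@weighted_pnorm R p N d (fun n : 'I_N.+1 => eps ^+ n)) U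
  <= (\sum_(i < N) (eps * a) ^+ i) * (eps * b).
Proof.
move=> hp e0 a0 b0 Ga Bb.
pose wt (V : 'M[R]_(N.+1, d)) : 'M[R]_(N.+1, d) :=
  \matrix_(n < N.+1, j < d) (eps ^+ n * V n j).
have row_wt V n : (n <= N)%N ->
    row (inord n) (wt V) = eps ^+ n *: row (inord n) V.
  by move=> nN; apply/rowP => j; rewrite !mxE inordK.
apply: opnorm_le => [|H H1].
  rewrite /weighted_pnorm (_ : \matrix_(_, _) _ = 0) ?pnorm0//.
  by apply/matrixP => i j; rewrite !mxE mulr0.
set K := H + _.
have K0 : row (inord 0) K = 0 by exact: row0_iteration_diff.
have KS n (nN : (n < N)%N) := rowS_iteration_diff n U H nN.
rewrite /= -/K in KS; move: K K0 KS => K K0 KS.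
apply: (@le_trans _ _ ((\sum_(i < N) (eps * a) ^+ i) * (eps * b) *
    pnorm p (wt H))); last first.
  rewrite ler_piMr// mulr_ge0 ?mulr_ge0//.
  by apply: sumr_ge0 => i _; rewrite exprn_ge0// mulr_ge0.
apply: pnorm_recursion => //; rewrite ?mulr_ge0//.
  by rewrite row_wt// K0 scaler0.
move=> n nN; rewrite !row_wt ?(ltnW nN)//.
rewrite !pnormZ// !ger0_norm ?exprn_ge0// exprS -!mulrA -mulrDr.
rewrite ler_wpM2l// [a * _]mulrCA [b * _]mulrCA -mulrDr ler_wpM2l ?exprn_ge0//.
rewrite KS//.
apply: le_trans (ler_pnormD _ _ _ hp) _; apply: lerD.
  apply: le_trans (pnorm_mulmx_opnorm _ hp _ _) _.
  by rewrite ler_wpM2r ?pnorm_ge0// Ga.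
apply: le_trans (pnorm_mulmx_opnorm _ hp _ _) _.
by rewrite ler_wpM2r ?pnorm_ge0// Bb.
Qed.

End Iteration.

(** * Local contraction and the global bound *)

Section Bounds.
Context {R : realType} {d N : nat} (u0 : 'rV[R]_d) (F G : 'rV[R]_d -> 'rV[R]_d).
Context (hF : continuously_differentiable F).
Context (hG : continuously_differentiable G).
Implicit Types (U H : 'M[R]_(N.+1, d)) (n : nat).

Lemma jacobians_locally_bounded U :
  exists2 M : R, 0 <= M & \forall V \near U, forall n : 'I_N,
    `|jacobian G (new_chunk u0 F G n V)| <= M /\
    `|jacobian F (row (inord n) V) - jacobian G (row (inord n) V)| <= M.
Proof.
have [dF cF] := hF; have [dG cG] := hG.
pose A (n : 'I_N) (V : 'M[R]_(N.+1, d)) := jacobian G (new_chunk u0 F G n V).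
pose B (n : 'I_N) (V : 'M[R]_(N.+1, d)) :=
  jacobian F (row (inord n) V) - jacobian G (row (inord n) V).
have cA (n : 'I_N) : {for U, continuous (A n)}.
  apply: (@continuous_comp _ _ _ (new_chunk u0 F G n) (jacobian G)).
    exact/differentiable_continuous/differentiable_new_chunk.
  exact: cG.
have cB (n : 'I_N) : {for U, continuous (B n)}.
  have cJ (f : 'rV[R]_d -> 'rV[R]_d) : continuous (jacobian f) ->
      {for U, continuous (fun V => jacobian f (row (inord n) V))}.
    move=> cf; apply: (@continuous_comp _ _ _ (@row R N.+1 d (inord n))).
      exact: row_continuous.
    exact: cf.
  exact: cvgB (cJ F cF) (cJ G cG).
(* The sum dominates each of the finitely many norms at U; the extra 1 leaves
   room for nearby points. *)
pose M := \sum_(n < N) (`|A n U| + `|B n U|) + 1.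
have AM (n : 'I_N) : `|A n U| + `|B n U| < M.
  rewrite /M (bigD1 n)//= -addrA ltrDl ltr_wpDl//.
  by apply: sumr_ge0 => i _; rewrite addr_ge0.
exists M; first by rewrite addr_ge0// sumr_ge0// => i _; rewrite addr_ge0.
apply: (filter_forall (F := nbhs U)) => n; near=> V; split.
  near: V; apply: (cvgr_norm_le (A n U)); first exact: cA.
  by apply: le_lt_trans (AM n); rewrite lerDl.
near: V; apply: (cvgr_norm_le (B n U)); first exact: cB.
by apply: le_lt_trans (AM n); rewrite lerDr.
Unshelve. all: by end_near. Qed.

(** The iteration matrix is block strictly lower triangular, which is why some
    rescaling of the chunks makes it a contraction however large the Jacobians
    are. *)
Lemma weighted_contraction p : (1 <= p)%E -> (1 <= N)%N ->
  exists w : 'I_N.+1 -> R, (forall n : 'I_N.+1, 0 < w n) /\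
    locally_contractive u0 F G (@weighted_pnorm R p N d w).
Proof.
move=> hp N1; have [dF _] := hF; have [dG _] := hG.
have [M M0 nearM] := jacobians_locally_bounded (fine_solution u0 F N).
have N0 : 0 < N%:R :> R by rewrite ltr0n.
pose L := @opnorm_const R d p * M.
have L0 : 0 <= L by rewrite mulr_ge0// opnorm_const_ge0.
(* Then eps L <= 1/(2N) <= 1, so the geometric sum is at most N and the bound
   N eps L is at most 1/2. *)
pose eps := (2 * N%:R * (1 + L))^-1.
have e0 : 0 < eps by rewrite invr_gt0 !mulr_gt0// ltr_pwDl.
have eL : eps * L <= (2 * N%:R)^-1.
  have L1 : 0 < 1 + L by exact: ltr_pwDl.
  have -> : eps * L = (2 * N%:R)^-1 * (L / (1 + L)).
    by rewrite /eps; field; rewrite !gt_eqF.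
  rewrite ler_piMr ?invr_ge0 ?mulr_ge0 ?(ltW N0)//.
  by rewrite ler_pdivrMr// mul1r lerDr.
exists (fun n : 'I_N.+1 => eps ^+ n); split=> [n|]; first exact: exprn_gt0.
have /nbhs_ballP[r /= r0 ballM] := nearM.
exists (ball (fine_solution u0 F N) r), 2^-1; split.
- exact: ball_open.
- exact: mx_ball_convex.
- exact: ballxx.
- by rewrite invf_lt1// ltr1n.
move=> U /ballM UM.
have bound : iteration_jacobian_norm u0 F G
    (@weighted_pnorm R p N d (fun n : 'I_N.+1 => eps ^+ n)) U
    <= (\sum_(i < N) (eps * L) ^+ i) * (eps * L).
  apply: iteration_jacobian_norm_le => //; first exact: ltW.
    move=> n nN; apply: le_trans (opnorm_mulmx_le _ hp _) _.
    by rewrite ler_wpM2l ?opnorm_const_ge0//; case: (UM (Ordinal nN)).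
  move=> n nN; apply: le_trans (opnorm_mulmx_le _ hp _) _.
  by rewrite ler_wpM2l ?opnorm_const_ge0//; case: (UM (Ordinal nN)).
apply: le_trans bound _.
have eL0 : 0 <= eps * L by rewrite mulr_ge0 ?(ltW e0).
have eL1 : eps * L <= 1.
  apply: le_trans eL _; rewrite invf_le1 ?mulr_gt0//.
  by rewrite -natrM ler1n muln_gt0.
apply: (@le_trans _ _ (N%:R * (2 * N%:R)^-1)).
  apply: ler_pM => //.
    by apply: sumr_ge0 => i _; rewrite exprn_ge0.
  apply: (@le_trans _ _ (\sum_(i < N) 1)); last by rewrite sumr_const card_ord.
  by apply: ler_sum => i _; exact: exprn_ile1.
by rewrite invfM mulrCA mulfV ?gt_eqF// mulr1.
Qed.

Lemma iteration_jacobian_norm_le_beta p U : (1 <= p)%E -> (1 <= N)%N ->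
  ((iteration_jacobian_norm u0 F G (@pnorm R p N.+1 d) U)%:E <= beta p F G N)%E.
Proof.
move=> hp N1; have [dF _] := hF; have [dG _] := hG.
pose opn := opnorm (@pnorm R p 1 d) (@pnorm R p 1 d).
pose g (n : 'I_N) := opn (fun h => h *m jacobian G (new_chunk u0 F G n U)).
pose e (n : 'I_N) := opn (fun h => h *m
  (jacobian F (row (inord n) U) - jacobian G (row (inord n) U))).
pose i0 : 'I_N := Ordinal N1.
have [m _ gm] := @arg_maxP _ R _ i0 xpredT g isT.
have [l _ el] := @arg_maxP _ R _ i0 xpredT e isT.
have bound : iteration_jacobian_norm u0 F G (@pnorm R p N.+1 d) U
    <= (\sum_(i < N) g m ^+ i) * e l.
  rewrite (_ : @pnorm R p N.+1 d =
    weighted_pnorm p (fun n : 'I_N.+1 => 1 ^+ n)); last first.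
    apply/funext => V; congr pnorm; apply/matrixP => i j.
    by rewrite mxE expr1n mul1r.
  have := @iteration_jacobian_norm_le R d N u0 F G dF dG p 1 (g m) (e l) U hp
    ler01 (opnorm_mulmx_ge0 p hp _) (opnorm_mulmx_ge0 p hp _)
    (fun n nN => gm (Ordinal nN) isT) (fun n nN => el (Ordinal nN) isT).
  by rewrite !mul1r.
apply: (@le_trans _ _ ((\sum_(i < N) g m ^+ i)%:E * (e l)%:E)%E).
  by rewrite -EFinM lee_fin.
apply: lee_pmul.
- by rewrite lee_fin sumr_ge0// => i _; rewrite exprn_ge0// opnorm_mulmx_ge0.
- by rewrite lee_fin opnorm_mulmx_ge0.
- apply: ereal_sup_ubound.
  (* The maximizing point T_m(U) need not be a chunk of U; it is a chunk of the
     constant stacked vector. *)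
  exists (\matrix_(_ < N.+1) new_chunk u0 F G m U), (inord 1).
  split; first by rewrite inordK.
  congr EFin; apply: eq_bigr => i _; congr (_ ^+ _); rewrite rowK /g /opn.
  by congr opnorm; apply/funext => h; rewrite diff_jacobian.
- apply: ereal_sup_ubound; exists U, (inord l); split.
    by rewrite inordK ?leqW// -ltnS prednK// ltn_ord.
  congr EFin; rewrite /e /opn; congr opnorm; apply/funext => h.
  rewrite mulmxBr; congr (_ - _); apply: esym; exact: diff_jacobian.
Qed.
End Bounds.


Theorem theorem4p1 (R : realType) (d N : nat) (hd : (1 <= d)%N) (hN : (1 <= N)%N)
    (u0 : 'rV[R]_d) (F G : 'rV[R]_d -> 'rV[R]_d) (p : \bar R) (hp : (1 <= p)%E)
    (hF : continuously_differentiable F) (hG : continuously_differentiable G) :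
  (exists w : 'I_N.+1 -> R,
     (forall n, 0 < w n) /\
     locally_contractive u0 F G (@weighted_pnorm R p N d w)) /\
  (forall U : 'M[R]_(N.+1, d),
     differentiable (@parareal_v R d u0 F G N) U /\
     ((iteration_jacobian_norm u0 F G (@pnorm R p N.+1 d) U)%:E <= beta p F G N)%E).
Proof.
have [dF _] := hF; have [dG _] := hG.
split; first exact: weighted_contraction.
move=> U; split; first exact: differentiable_parareal_v.
exact: iteration_jacobian_norm_le_beta.
Qed.
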